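(* Let $S$ be an irreducible Rees monoid with group of units $G$, and let $\phi\colon A\rightarrow B$ be an associated partial automorphism of $G$. Then the universal group of $S$ is isomorphic to the group HNN extension $$G^{\ast}=\mathrm{Grp}\langle G,t\colon at=t\phi(a)\ \mbox{for all } a\in A\rangle$$ and $S$ can be embedded in $G^{\ast}$.
   Context: A length function on a monoid $S$ is a monoid homomorphism $\lambda \colon S \rightarrow \mathbb{N}$ to the additive monoid of natural numbers (including $0$) such that $\lambda^{-1}(0)$ is the group of units of $S$. A monoid $S$ is equidivisible if for all $a,b,c,d\in S$, $ab=cd$ implies that either $a=cu$ and $d=ub$ for some $u\in S$, or $c=av$ and $b=vd$ for some $v\in S$. A Rees monoid is a cancellative equidivisible monoid equipped with a length function and containing at least one noninvertible element. An atom is a noninvertible element $a$ such that $a=bc$ implies that $b$ or $c$ is invertible. A Rees monoid $S$ with group of units $G$ is irreducible if for all atoms $x,y$ there are $g,h\in G$ with $y=gxh$. Associated partial automorphism: choose an atom $x$ of $S$ and put $A=\{g\in G\colon gx\in xG\}$, $B=\{h\in G\colon xh\in Gx\}$, which are subgroups of $G$; the map $\phi\colon A\rightarrow B$ defined by $\phi(g)=h$ iff $gx=xh$ is an isomorphism, called an associated partial automorphism of $G$. The universal group of a monoid $S$ is a group $U(S)$ with a homomorphism $\iota\colon S\rightarrow U(S)$ such that for each homomorphism $\phi\colon S\rightarrow L$ to a group $L$ there is a unique homomorphism $\bar{\phi}\colon U(S)\rightarrow L$ with $\phi=\bar{\phi}\iota$. $\mathrm{Grp}\langle G,t\colon\ldots\rangle$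 denotes the group generated by $G$ and a new letter $t$ subject to all relations holding in $G$ and the displayed relations. *)

(* Defs.v *)
From HB Require Import structures.
From mathcomp Require Import all_boot.
From mathcomp Require Import boolp classical_sets.

Set Implicit Arguments.
Unset Strict Implicit.
Unset Printing Implicit Defensive.

Local Open Scope group_scope.
Local Open Scope quotient_scope.

(* Between groups these are the group homomorphisms. *)
Notation monoid_hom := UMagmaMorphism.type (only parsing).

Section Units.
Variable S : monoidType.

Definition invertible (a : S) : Prop := exists b : S, a * b = 1 /\ b * a = 1.

Definition invertibleb : pred S := fun a => `[< invertible a >].

Record units : Type := Units { unit_val : S; unit_valP : invertibleb unit_val }.

HB.instance Definition _ := [isSub of units for unit_val].
HB.instance Definition _ := [Choice of units by <:].

Lemma units_mulg_closed : umagma_closed invertibleb.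
Proof.
split; first by apply/asboolP; exists 1; rewrite mulg1.
move=> a b /asboolP[a' [aa' a'a]] /asboolP[b' [bb' b'b]].
apply/asboolP; exists (b' * a'); split.
- by rewrite mulgA -(mulgA a) bb' mulg1.
- by rewrite mulgA -(mulgA b') a'a mulg1.
Qed.

HB.instance Definition _ :=
  SubChoice_isSubMonoid.Build S invertibleb units units_mulg_closed.

Lemma unit_inv_ex (a : units) : exists b : units, a * b = 1 /\ b * a = 1.
Proof.
have /asboolP[b [ab ba]] := valP a.
have ib : invertibleb b by apply/asboolP; exists (val a).
by exists (Units ib); split; apply: val_inj.
Qed.

Definition unit_inv (a : units) : units := projT1 (cid (unit_inv_ex a)).

Lemma unit_mulVg : left_inverse 1 unit_inv (@mul units).
Proof. by move=> a; rewrite /unit_inv; case: cid => b []. Qed.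

Lemma unit_mulgV : right_inverse 1 unit_inv (@mul units).
Proof. by move=> a; rewrite /unit_inv; case: cid => b []. Qed.

HB.instance Definition _ := hasInv.Build units unit_inv.
HB.instance Definition _ := Monoid_isGroup.Build units unit_mulVg unit_mulgV.

End Units.

Section ReesMonoids.
Variable S : monoidType.

Definition length_function (lambda : S -> nat) : Prop :=
  [/\ lambda 1 = 0%N,
      forall a b, lambda (a * b) = (lambda a + lambda b)%N
    & forall a, lambda a = 0%N <-> invertible a].

Definition equidivisible : Prop :=
  forall a b c d : S, a * b = c * d ->
    (exists u, a = c * u /\ d = u * b) \/ (exists v, c = a * v /\ b = v * d).

Definition cancellative : Prop :=
  left_injective (@mul S) /\ right_injective (@mul S).

Definition rees_monoid : Prop :=
  [/\ cancellative, equidivisible, exists lambda, length_function lambda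
    & exists a : S, ~ invertible a].

Definition atom (a : S) : Prop :=
  ~ invertible a /\
  forall b c, a = b * c -> invertible b \/ invertible c.

Definition irreducible_monoid : Prop :=
  forall x y : S, atom x -> atom y ->
    exists g h : units S, y = val g * x * val h.

Definition associated_dom (x : S) : set (units S) :=
  [set g | exists h : units S, val g * x = x * val h]%classic.

Definition associated_cod (x : S) : set (units S) :=
  [set h | exists g : units S, x * val h = val g * x]%classic.

(* In [val (val g)], the inner [val] is the inclusion of the set [A], seen as a
   type, into [units S], and the outer one is that of [units S] into [S]. *)
Definition associated_partial_automorphism (A B : set (units S))
    (phi : A -> B) : Prop :=
  exists x : S,
    [/\ atom x, A = associated_dom x, B = associated_cod x
      & forall (g : A) (h : B),
          phi g = h <-> val (val g) * x = x * val (val h)].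

Definition is_universal_group (U : groupType)
    (iota : monoid_hom S U) : Prop :=
  forall (L : groupType) (f : monoid_hom S L),
  exists fbar : monoid_hom U L,
    f =1 fbar \o iota /\
    forall fbar' : monoid_hom U L,
      f =1 fbar' \o iota -> fbar' =1 fbar.

End ReesMonoids.

(* [(x, true)] stands for the letter x and [(x, false)] for its inverse. *)
Definition word (X : Type) : Type := seq (X * bool).

Definition word_eval (X : Type) (L : groupType) (f : X -> L) (w : word X) : L :=
  \prod_(p <- w) (if p.2 then f p.1 else (f p.1)^-1).

Section PresentedGroup.
Variables (X : choiceType) (R : word X -> word X -> Prop).

Inductive word_cong : word X -> word X -> Prop :=
| word_cong_refl u : word_cong u u
| word_cong_sym u v : word_cong u v -> word_cong v u
| word_cong_trans u v w : word_cong u v -> word_cong v w -> word_cong u w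
| word_cong_cat u u' v v' :
    word_cong u u' -> word_cong v v' -> word_cong (u ++ v) (u' ++ v')
| word_cong_cancel x b : word_cong [:: (x, b); (x, ~~ b)] [::]
| word_cong_rel u v : R u v -> word_cong u v.

Definition word_congb : rel (word X) := fun u v => `[< word_cong u v >].

Lemma word_congb_refl : reflexive word_congb.
Proof. by move=> u; apply/asboolP; apply: word_cong_refl. Qed.

Lemma word_congb_sym : symmetric word_congb.
Proof.
by move=> u v; apply/idP/idP => /asboolP h; apply/asboolP; apply: word_cong_sym.
Qed.

Lemma word_congb_trans : transitive word_congb.
Proof.
move=> v u w /asboolP h1 /asboolP h2.
by apply/asboolP; apply: word_cong_trans h1 h2.
Qed.

Canonical word_congb_equiv :=
  EquivRel word_congb word_congb_refl word_congb_sym word_congb_trans.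

(* The group with generators X and defining relations u = v for R u v. *)
Definition presented_group : Type := {eq_quot word_congb}.

HB.instance Definition _ := Choice.on presented_group.
HB.instance Definition _ := EqQuotient.on presented_group.

Definition word_class (w : word X) : presented_group :=
  \pi_(presented_group) w.

Lemma word_classP u v : word_class u = word_class v <-> word_cong u v.
Proof.
split; first by move=> /eqquotP /asboolP.
by move=> h; apply/eqquotP/asboolP.
Qed.

Lemma word_class_repr q : word_class (repr q) = q.
Proof. exact: reprK. Qed.

Definition word_inv (w : word X) : word X :=
  rev [seq (p.1, ~~ p.2) | p <- w].

Definition presented_mul (p q : presented_group) : presented_group :=
  word_class (repr p ++ repr q).

Definition presented_one : presented_group := word_class [::].

Definition presented_inv (p : presented_group) : presented_group :=
  word_class (word_inv (repr p)).

Lemma word_class_cat u v :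
  presented_mul (word_class u) (word_class v) = word_class (u ++ v).
Proof.
by apply/word_classP/word_cong_cat; apply/word_classP/word_class_repr.
Qed.

Lemma presented_mulA : associative presented_mul.
Proof.
move=> p q r; rewrite -(word_class_repr p) -(word_class_repr q).
by rewrite -(word_class_repr r) !word_class_cat catA.
Qed.

Lemma presented_mul1 : left_id presented_one presented_mul.
Proof. by move=> p; rewrite -(word_class_repr p) word_class_cat. Qed.

Lemma presented_mulr1 : right_id presented_one presented_mul.
Proof. by move=> p; rewrite -(word_class_repr p) word_class_cat cats0. Qed.

Lemma word_cong_invr w : word_cong (w ++ word_inv w) [::].
Proof.
elim: w => [|[x b] w IHw]; first exact: word_cong_refl.
apply: (word_cong_trans _ (word_cong_cancel x b)).
rewrite /word_inv /= rev_cons -cats1 catA -cat1s -[[:: _; _]]cat1s.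
apply: word_cong_cat; first exact: word_cong_refl.
rewrite -[X in word_cong _ X]cat0s.
by apply: word_cong_cat => //; apply: word_cong_refl.
Qed.

Lemma word_invK : involutive word_inv.
Proof.
move=> w; rewrite /word_inv map_rev revK -map_comp.
by rewrite -[RHS]map_id; apply: eq_map => -[x b] /=; rewrite negbK.
Qed.

Lemma presented_mulV : right_inverse presented_one presented_inv presented_mul.
Proof.
move=> p; rewrite -[X in presented_mul X _]word_class_repr /presented_inv.
rewrite word_class_cat.
exact/word_classP/word_cong_invr.
Qed.

Lemma presented_Vmul : left_inverse presented_one presented_inv presented_mul.
Proof.
move=> p; rewrite -[X in presented_mul _ X]word_class_repr /presented_inv.
rewrite word_class_cat.
by apply/word_classP; rewrite -[X in _ ++ X]word_invK; apply: word_cong_invr.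
Qed.

HB.instance Definition _ := isMonoid.Build presented_group
  presented_mulA presented_mul1 presented_mulr1.
HB.instance Definition _ := hasInv.Build presented_group presented_inv.
HB.instance Definition _ :=
  Monoid_isGroup.Build presented_group presented_Vmul presented_mulV.

Definition presented_gen (x : X) : presented_group := word_class [:: (x, true)].

Lemma word_classM u v : word_class (u ++ v) = word_class u * word_class v.
Proof. by rewrite -word_class_cat. Qed.

Lemma word_class_eval w : word_class w = word_eval presented_gen w.
Proof.
rewrite /word_eval; elim: w => [|[x b] w IHw]; first by rewrite big_nil.
rewrite big_cons -IHw -cat1s word_classM; congr (_ * _).
case: b => //=; apply: (@mulgI _ (presented_gen x)); rewrite mulgV.
by rewrite -word_classM; apply/word_classP/word_cong_cancel.
Qed.

Section Lift.
Variables (L : groupType) (f : X -> L).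
Hypothesis fR : forall u v, R u v -> word_eval f u = word_eval f v.

Lemma word_cong_eval u v : word_cong u v -> word_eval f u = word_eval f v.
Proof.
elim=> //.
- by move=> {}u {}v w _ -> _ ->.
- by move=> u1 u2 v1 v2 _ h1 _ h2; rewrite /word_eval !big_cat /=; congr (_ * _).
- move=> x b; rewrite /word_eval big_cons big_seq1 big_nil.
  by case: b => /=; rewrite ?mulgV ?mulVg.
Qed.

Definition presented_lift (p : presented_group) : L := word_eval f (repr p).

Lemma presented_lift_class w : presented_lift (word_class w) = word_eval f w.
Proof. exact/word_cong_eval/word_classP/word_class_repr. Qed.

Lemma presented_lift1 : presented_lift 1 = 1.
Proof. by rewrite presented_lift_class /word_eval big_nil. Qed.

Lemma presented_liftM : {morph presented_lift : p q / p * q}.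
Proof.
move=> p q; rewrite -(word_class_repr p) -(word_class_repr q) -word_classM.
by rewrite !presented_lift_class /word_eval big_cat.
Qed.

Lemma presented_lift_gen x : presented_lift (presented_gen x) = f x.
Proof. by rewrite presented_lift_class /word_eval big_seq1. Qed.

End Lift.

Lemma presented_ext (L : groupType) (h k : monoid_hom presented_group L) :
  (forall x, h (presented_gen x) = k (presented_gen x)) -> h =1 k.
Proof.
move=> hk p; rewrite -(word_class_repr p) word_class_eval /word_eval.
elim: (repr p) => [|[x b] w IHw]; first by rewrite big_nil !gmulf1.
rewrite big_cons !gmulfM IHw; congr (_ * _).
by case: b; rewrite /= ?gmulfV hk.
Qed.

End PresentedGroup.

Section UniversalGroup.
Variable S : monoidType.

Inductive universal_rel : word S -> word S -> Prop :=
| universal_rel_mul a b :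
    universal_rel [:: (a, true); (b, true)] [:: (a * b, true)].

Definition universal_group : groupType := presented_group universal_rel.

Definition universal_map (a : S) : universal_group :=
  presented_gen universal_rel a.

Lemma universal_mapM : {morph universal_map : a b / a * b}.
Proof.
move=> a b; rewrite /universal_map /presented_gen -word_classM.
by apply/esym/word_classP/word_cong_rel; constructor.
Qed.

Lemma universal_map1 : universal_map 1 = 1.
Proof.
by apply: (@mulgI _ (universal_map 1)); rewrite -universal_mapM !mulg1.
Qed.

HB.instance Definition _ := isMultiplicative.Build S universal_group
  universal_map universal_mapM.
HB.instance Definition _ := Multiplicative_isUMagmaMorphism.Build
  S universal_group universal_map universal_map1.

Lemma universal_groupP : is_universal_group universal_map.
Proof.
move=> L f.
have fR u v : universal_rel u v -> word_eval f u = word_eval f v.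
  by case=> a b; rewrite /word_eval big_cons !big_seq1 /= gmulfM.
pose m := isMultiplicative.Build _ _ _ (presented_liftM fR).
pose m1 := Multiplicative_isUMagmaMorphism.Build _ _ _ (presented_lift1 fR).
pose fbar : monoid_hom universal_group L :=
  HB.pack (presented_lift (R := universal_rel) f) m m1.
exists fbar; split; first by move=> a /=; rewrite presented_lift_gen.
move=> fbar' hf; apply: presented_ext => a.
rewrite [RHS]presented_lift_gen //; exact/esym/hf.
Qed.

End UniversalGroup.

Section HNNExtension.
Variables (G : groupType) (A B : set G) (phi : A -> B).

(* The generators are the [Some g] with g in G, and the new letter t, which
   is [None]. *)
Inductive hnn_rel : word (option G) -> word (option G) -> Prop :=
| hnn_rel_base (u v : word G) :
    word_eval idfun u = word_eval idfun v ->
    hnn_rel [seq (Some p.1, p.2) | p <- u] [seq (Some p.1, p.2) | p <- v]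
| hnn_rel_stable (a : A) :
    hnn_rel [:: (Some (val a), true); (None, true)]
            [:: (None, true); (Some (val (phi a)), true)].

Definition hnn_extension : groupType := presented_group hnn_rel.

End HNNExtension.

(* Main.v *)
Require Import Defs.
From HB Require Import structures.
From mathcomp Require Import all_boot.
From mathcomp Require Import boolp classical_sets functions cardinality.

(* Equidivisibility and the length function show that every element of S is a
   product [g0 x g1 ... x gn] with g0, ..., gn units and x a fixed atom, and that
   two such products are equal only as a consequence of the relations [a x = x b]
   holding in S. So S is the monoid generated by G and x subject to these
   relations, and its universal group is presented by the same data, which is
   the HNN extension.

   For the embedding it suffices to let the HNN extension act on a set containing
   S so that G and t extend left multiplication by G and by x: the image of 1
   then recovers an element of S. Left multiplication by x is an injection of S
   intertwining the free actions of B and of A. After adding to S a large free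
   G-set, the complements of its domain and of its range have the same number of
   orbits under B and A respectively, so it extends to a permutation. *)

Set Implicit Arguments.
Unset Strict Implicit.
Unset Printing Implicit Defensive.

Local Open Scope group_scope.

(** * Calculation with units inside the monoid *)

Section UnitsTheory.
Variable S : monoidType.
Implicit Types (g : units S) (s : S).

Lemma val_unit1 : val (1 : units S) = 1.
Proof. by []. Qed.

Lemma val_unitM g h : val (g * h) = val g * val h.
Proof. by []. Qed.

Lemma val_unitV g : val g^-1 * val g = 1.
Proof. by rewrite -val_unitM mulVg. Qed.

Lemma val_unitVr g : val g * val g^-1 = 1.
Proof. by rewrite -val_unitM mulgV. Qed.

Lemma val_unitK g s : val g^-1 * (val g * s) = s.
Proof. by rewrite mulgA val_unitV mul1g. Qed.

Lemma val_unitVK g s : val g * (val g^-1 * s) = s.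
Proof. by rewrite mulgA val_unitVr mul1g. Qed.

Lemma val_invertible g : invertible (val g).
Proof. exact/asboolP/(valP g). Qed.

Lemma invertibleP s : invertible s <-> exists g : units S, s = val g.
Proof.
split=> [si | [g ->]]; last exact: val_invertible.
by exists (Units (asboolT si)).
Qed.

End UnitsTheory.

(** * Presentation of S by its units and one atom *)

Section ReesPresentation.
Variables (S : monoidType) (x : S).
Hypotheses (S_rees : rees_monoid S) (S_irr : irreducible_monoid S).
Hypothesis x_atom : atom x.
Implicit Types (g h : units S) (s : S).

Lemma rees_invertibleMl (a b : S) : invertible (a * b) -> invertible a.
Proof.
have [_ _ [lam [_ lamM lam0]] _] := S_rees.
by move=> /lam0; rewrite lamM => /eqP; rewrite addn_eq0 => /andP[/eqP/lam0].
Qed.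

Lemma rees_invertibleMr (a b : S) : invertible (a * b) -> invertible b.
Proof.
have [_ _ [lam [_ lamM lam0]] _] := S_rees.
by move=> /lam0; rewrite lamM => /eqP; rewrite addn_eq0 => /andP[_ /eqP/lam0].
Qed.

(** Strong induction on length: an atom is [g x h] by irreducibility, and any other noninvertible
    element splits into two noninvertible factors, both shorter because each has positive length. *)
Lemma rees_ind (P : S -> Prop) :
  (forall g, P (val g)) -> P x -> (forall a b, P a -> P b -> P (a * b)) ->
  forall s, P s.
Proof.
have [_ _ [lam [_ lamM lam0]] _] := S_rees.
move=> PG Px PM s; have [n] := ubnP (lam s); elim: n s => // n IHn s.
rewrite ltnS => les.
have [/invertibleP[g ->] //|sN] := pselect (invertible s).
have [s_atom|] := pselect (atom s).
  by have [g [h ->]] := S_irr x_atom s_atom; do 2?[apply: (PM)].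
move=> /not_andP[//|] /existsNP[a] /existsNP[b] /not_implyP[sE].
move=> /not_orP[aN bN].
have lam_gt0 c : ~ invertible c -> (0 < lam c)%N.
  by move=> cN; rewrite lt0n; apply/eqP => /lam0.
move: les; rewrite sE lamM => les; apply: PM; apply: IHn.
  by rewrite (leq_trans _ les) // -addn1 leq_add2l lam_gt0.
by rewrite (leq_trans _ les) // -add1n leq_add2r lam_gt0.
Qed.

Lemma rees_hom_ext (M : monoidType) (f f' : monoid_hom S M) :
  (forall g, f (val g) = f' (val g)) -> f x = f' x -> f =1 f'.
Proof.
by move=> fG fx; apply: rees_ind => // a b fa fb; rewrite !gmulfM fa fb.
Qed.

(* In [g x = g' x u] the factor [u] has length 0, hence is a unit. *)
Lemma rees_atom_cancel g g' s s' :
  val g * x * s = val g' * x * s' ->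
  exists a b : units S, [/\ val a * x = x * val b, g = g' * a & s' = val b * s].
Proof.
have [_ eqd [lam [_ lamM lam0]] _] := S_rees.
have lamG (k : units S) : lam (val k) = 0%N by apply/lam0/val_invertible.
have unit_factor (k k' : units S) u :
      val k * x = val k' * x * u -> invertible u.
  move=> /(congr1 lam); rewrite !lamM !lamG !add0n -[LHS]addn0.
  by move=> /addnI/esym/lam0.
have aux (k k' h : units S) :
      val k * x = val k' * x * val h -> val (k'^-1 * k) * x = x * val h.
  by rewrite val_unitM -!mulgA => ->; rewrite val_unitK.
move=> /eqd[[u [E ->]]|[v [E ->]]].
  have /invertibleP[h uE] := unit_factor _ _ _ E.
  exists (g'^-1 * g), h; rewrite mulgA mulgV mul1g uE; split=> //.
  by apply: aux; rewrite -uE.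
have /invertibleP[h vE] := unit_factor _ _ _ E.
exists (g'^-1 * g), h^-1; rewrite mulgA mulgV mul1g vE val_unitK; split=> //.
by apply: aux; rewrite E vE -!mulgA val_unitVr mulg1.
Qed.

Section Lift.
Variables (L : groupType) (gam : monoid_hom (units S) L) (t : L).
Hypothesis gam_t : forall a b : units S,
  val a * x = x * val b -> gam a * t = t * gam b.

(** The graph of the homomorphism to be built. It is a relation because an element has many
    expansions; that it is single-valued is a separate matter. *)
Inductive atom_expansion : S -> L -> Prop :=
| atom_expansion_unit g : atom_expansion (val g) (gam g)
| atom_expansion_cons g s w : atom_expansion s w ->
    atom_expansion (val g * x * s) (gam g * t * w).

Lemma atom_expansion_unitM g s w :
  atom_expansion s w -> atom_expansion (val g * s) (gam g * w).
Proof.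
case=> [h|h s' w' e].
  by rewrite -val_unitM -(gmulfM (s := gam)); constructor.
by rewrite !mulgA -val_unitM -(gmulfM (s := gam)); constructor.
Qed.

Lemma atom_expansionM s w s' w' :
  atom_expansion s w -> atom_expansion s' w' ->
  atom_expansion (s * s') (w * w').
Proof.
move=> + e'; elim=> [g|g s0 w0 _ IHs]; first exact: atom_expansion_unitM.
by rewrite -!(mulgA _ _ s') -!(mulgA _ _ w'); constructor.
Qed.

Lemma atom_expansion_atom : atom_expansion x t.
Proof.
have := atom_expansion_cons 1 (atom_expansion_unit 1).
by rewrite !gmulf1 !mul1g !mulg1.
Qed.

Lemma atom_expansion_total s : exists w, atom_expansion s w.
Proof.
elim/rees_ind: s => [g||a b [u eu] [v ev]].
- by exists (gam g); constructor.
- by exists t; apply: atom_expansion_atom.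
- by exists (u * v); apply: atom_expansionM.
Qed.

Let atom_cons_not_unit g h s : val g <> val h * x * s.
Proof.
move=> E; have := val_invertible g.
by rewrite E => /rees_invertibleMl /rees_invertibleMr; have [] := x_atom.
Qed.

(** Two expansions of one element have leading terms that differ by some [a x = x b], and
    [gam a * t = t * gam b] carries that difference into the tails. *)
Lemma atom_expansion_fun s w w' :
  atom_expansion s w -> atom_expansion s w' -> w = w'.
Proof.
move=> e; elim: e w' => {s w} [g|g s w e IHs] w' e'.
  move sE: (val g) e' => s e'; case: e' sE => [h /val_inj-> //|h s' w0 _].
  by move/atom_cons_not_unit.
move s1E: (val g * x * s) e' => s1 e'; case: e' s1E.
  by move=> h /esym/atom_cons_not_unit.
move=> g' s' w0 e' /rees_atom_cancel.
move=> [a [b [ab -> s'E]]].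
(* The tails satisfy [s = b^-1 s'], so [gam b^-1 * w0] is another value for [s] and the induction
   hypothesis applies. *)
have -> : w = gam b^-1 * w0.
  by apply: IHs; rewrite -(val_unitK b s) -s'E; apply: atom_expansion_unitM.
by rewrite gmulfM -(mulgA _ _ t) (gam_t ab) gmulfV !mulgA mulgK.
Qed.

Lemma rees_lift :
  exists f : monoid_hom S L, (forall g, f (val g) = gam g) /\ f x = t.
Proof.
have [f fE] := choice atom_expansion_total.
have f1 : f 1 = 1.
  apply: atom_expansion_fun (fE 1) _.
  by have := atom_expansion_unit 1; rewrite !gmulf1.
have fM : {morph f : a b / a * b}.
  move=> a b; apply: atom_expansion_fun (fE _) _.
  by apply: atom_expansionM; apply: fE.
pose m := isMultiplicative.Build _ _ f fM.
pose m1 := Multiplicative_isUMagmaMorphism.Build _ _ f f1.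
pose fhom : monoid_hom S L := HB.pack f m m1.
exists fhom; split=> [g|] /=.
  by apply: atom_expansion_fun (fE _) _; constructor.
exact: atom_expansion_fun (fE _) atom_expansion_atom.
Qed.

End Lift.

End ReesPresentation.

(** * Transversals of an equivalence relation and their cardinality *)

Section Transversal.
Variables (W : pointedType) (E : W -> set W).
Hypotheses (E_refl : forall w, E w w)
  (E_sym : forall w w', E w w' -> E w' w)
  (E_trans : forall w w' w'', E w w' -> E w' w'' -> E w w'').

(** Equivalent points have equal classes as sets, so [get] chooses the same representative for all
    of them. *)
Definition transversal (X : set W) : set W :=
  [set w | X w /\ get (E w) = w]%classic.

Lemma class_get w : E w (get (E w)).
Proof. by apply: (@getPex _ (E w)); exists w. Qed.

Lemma eq_class_get w w' : E w w' -> get (E w) = get (E w').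
Proof.
move=> ww'; congr (get _); apply/seteqP; split=> u; last exact: E_trans.
by apply: E_trans; apply: E_sym.
Qed.

Lemma transversal_unique X w w' :
  transversal X w -> transversal X w' -> E w w' -> w = w'.
Proof.
move=> [_ <-] [_ <-] /eq_class_get.
by rewrite -!(eq_class_get (class_get _)).
Qed.

Variable X : set W.
Hypothesis X_sat : forall w w', E w w' -> X w -> X w'.

Lemma transversal_get w : X w -> transversal X (get (E w)).
Proof.
move=> Xw; split; first exact: X_sat (class_get w) Xw.
exact/esym/eq_class_get/class_get.
Qed.

(** [C] meets each class at most once, so sending a point to its representative injects [C] into the
    transversal; the converse inequality comes from the size of [C]. *)
Lemma card_transversal (C : set W) :
  (C `<=` X)%classic -> (forall c c', C c -> C c' -> E c c' -> c = c') ->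
  ([set: W]%classic #<= C)%card -> (transversal X #= C)%card.
Proof.
move=> CX C_indep leC; apply: Cantor_Bernstein.
  exact: card_le_trans (subset_card_le (@subsetT _ _)) leC.
apply/pcard_leP/injfunPex; exists (fun w => get (E w)).
  by move=> c /CX; apply: transversal_get.
move=> c c' /set_mem Cc /set_mem Cc' e; apply: C_indep => //.
by apply: E_trans (class_get c) _; rewrite e; apply/E_sym/class_get.
Qed.

End Transversal.

(** * Equivariant bijections between parts of a free G-set *)

Section EquivariantBijection.
Variables (G : groupType) (W : pointedType) (act : G -> W -> W).
Hypotheses (act1 : forall w, act 1 w = w)
  (actM : forall g h w, act (g * h) w = act g (act h w))
  (act_free : forall g w, act g w = w -> g = 1).

Let actK g w : act g^-1 (act g w) = w.
Proof. by rewrite -actM mulVg act1. Qed.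

Let actI w : injective (act^~ w).
Proof.
move=> g h e; apply: (@mulgI _ h^-1); rewrite mulVg.
by apply: (act_free (w := w)); rewrite actM e actK.
Qed.

(** The graph of an isomorphism between two subgroups: a subgroup of the square of G that meets both
    factors trivially. As a relation it can be transposed, so that both sides share the same
    lemmas. *)
Definition partial_automorphism_graph (P : G -> G -> Prop) : Prop :=
  [/\ P 1 1, forall a b a' b', P a b -> P a' b' -> P (a * a') (b * b'),
      forall a b, P a b -> P a^-1 b^-1, forall a, P a 1 -> a = 1
    & forall b, P 1 b -> b = 1].

Lemma partial_automorphism_graphC P :
  partial_automorphism_graph P -> partial_automorphism_graph (fun a b => P b a).
Proof. by case=> P1 PM PV Pl Pr; split=> // *; [apply: PM|apply: PV]. Qed.

Definition cod_orbit (P : G -> G -> Prop) (w : W) : set W :=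
  [set w' | exists a b, P a b /\ w' = act b w]%classic.

Section Orbits.
Variable P : G -> G -> Prop.
Hypothesis P_graph : partial_automorphism_graph P.
Local Notation orbit := (cod_orbit P).

Lemma cod_orbit_refl w : orbit w w.
Proof. by have [P1 _ _ _ _] := P_graph; exists 1, 1. Qed.

Lemma cod_orbit_sym w w' : orbit w w' -> orbit w' w.
Proof.
have [_ _ PV _ _] := P_graph.
by move=> [a [b [ab ->]]]; exists a^-1, b^-1; rewrite actK; split; auto.
Qed.

Lemma cod_orbit_trans w w' w'' : orbit w w' -> orbit w' w'' -> orbit w w''.
Proof.
have [_ PM _ _ _] := P_graph.
move=> [a [b [ab ->]]] [a' [b' [ab' ->]]].
by exists (a' * a), (b' * b); rewrite actM; split; auto.
Qed.

Lemma transversal_coordinates X w :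
  (forall w w', orbit w w' -> X w -> X w') -> X w ->
  exists a b r, [/\ P a b, transversal orbit X r & w = act b r].
Proof.
move=> X_sat Xw.
have [a [b [ab e]]] := cod_orbit_sym (class_get cod_orbit_refl w).
exists a, b, (get (orbit w)); split=> //; apply: transversal_get => //.
- exact: cod_orbit_refl.
- exact: cod_orbit_sym.
- exact: cod_orbit_trans.
Qed.

(** The representatives agree since they lie in one orbit, freeness gives [b = b'], and then
    [a a'^-1] is related to 1. *)
Lemma transversal_coordinates_unique X a b r a' b' r' :
  P a b -> P a' b' -> transversal orbit X r -> transversal orbit X r' ->
  act b r = act b' r' -> [/\ a = a', b = b' & r = r'].
Proof.
have [P1 PM PV Pl Pr] := P_graph => ab ab' Tr Tr' e.
have rr' : r = r'.
  apply: (transversal_unique cod_orbit_refl cod_orbit_sym cod_orbit_trans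
            Tr Tr').
  exists (a'^-1 * a), (b'^-1 * b); split; first by apply: PM => //; apply: PV.
  by rewrite actM e actK.
have bb' : b = b' by apply: (@actI r); rewrite /= e rr'.
split=> //; apply: (@mulIg _ a'^-1); rewrite mulgV; apply: Pl.
by rewrite -(mulgV b') -{1}bb'; apply: PM => //; apply: PV.
Qed.

End Orbits.

(** The transversals of [X] and of [Y] are both equinumerous with [C]. A bijection [beta] between
    them extends by sending [b r] to [a beta(r)] whenever [P a b]. *)
Lemma equivariant_bijection (P : G -> G -> Prop) (X Y C : set W) :
  partial_automorphism_graph P ->
  (forall a b w, P a b -> X w -> X (act b w)) ->
  (forall a b w, P a b -> Y w -> Y (act a w)) ->
  (C `<=` X `&` Y)%classic ->
  (forall g c, C c -> C (act g c) -> g = 1) ->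
  ([set: W]%classic #<= C)%card ->
  exists tau : W -> W, set_bij X Y tau /\
    forall a b w, P a b -> X w -> tau (act b w) = act a (tau w).
Proof.
move=> Pg; have Qg := partial_automorphism_graphC Pg.
set Q := fun a b => P b a in Qg *.
move=> X_inv Y_inv CXY C_indep leC.
have X_sat w w' : cod_orbit P w w' -> X w -> X w'.
  by move=> [a [b [ab ->]]]; apply: X_inv ab.
have Y_sat w w' : cod_orbit Q w w' -> Y w -> Y w'.
  by move=> [a [b [ab ->]]]; apply: Y_inv ab.
have C_orbit R c c' : C c -> C c' -> cod_orbit R c c' -> c = c'.
  move=> Cc + [a [b [_ c'E]]]; rewrite c'E => /(C_indep _ _ Cc) ->.
  by rewrite act1.
set TX := transversal (cod_orbit P) X; set TY := transversal (cod_orbit Q) Y.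
have [beta [beta_fun beta_inj beta_surj]] : exists beta, set_bij TX TY beta.
  apply/card_set_bijP/(card_eq_trans (B := C)).
    apply: card_transversal; last exact: leC.
    - exact: cod_orbit_refl.
    - exact: cod_orbit_sym.
    - exact: cod_orbit_trans.
    - exact: X_sat.
    - by move=> c /CXY[].
    - exact: C_orbit.
  apply/card_esym/card_transversal; last exact: leC.
  - exact: cod_orbit_refl.
  - exact: cod_orbit_sym.
  - exact: cod_orbit_trans.
  - exact: Y_sat.
  - by move=> c /CXY[].
  - exact: C_orbit.
pose R w w' := exists a b r,
  [/\ P a b, TX r, w = act b r & w' = act a (beta r)].
have R_fun w w1 w2 : R w w1 -> R w w2 -> w1 = w2.
  move=> [a [b [r [ab Tr -> ->]]]] [a' [b' [r' [ab' Tr' e ->]]]].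
  by have [-> _ ->] := transversal_coordinates_unique Pg ab ab' Tr Tr' e.
have R_inj w1 w2 w : R w1 w -> R w2 w -> w1 = w2.
  move=> [a [b [r [ab Tr -> ->]]]] [a' [b' [r' [ab' Tr' -> e]]]].
  have [-> _ /beta_inj -> //] := transversal_coordinates_unique Qg
    (ab : Q b a) (ab' : Q b' a') (beta_fun _ Tr) (beta_fun _ Tr') e.
  - exact: mem_set.
  - exact: mem_set.
have R_total w : exists w', X w -> R w w'.
  (* Outside [X] the requirement is void and [w] is a dummy value. *)
  have [Xw|] := pselect (X w); last by exists w.
  have [a [b [r [ab Tr ->]]]] := transversal_coordinates Pg X_sat Xw.
  by exists (act a (beta r)) => _; exists a, b, r.
have R_act a b w w' : P a b -> R w w' -> R (act b w) (act a w').
  have [_ PM _ _ _] := Pg => ab [a' [b' [r [ab' Tr -> ->]]]].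
  by exists (a * a'), (b * b'), r; rewrite !actM; split=> //; apply: PM.
have [tau tauR] := choice R_total.
exists tau; split; last first.
  move=> a b w ab Xw; apply: R_fun (tauR _ (X_inv _ _ _ ab Xw)) _.
  exact/R_act/tauR.
split.
- move=> w /tauR[a [b [r [ab /beta_fun[Yr _] _ ->]]]]; exact: Y_inv ab Yr.
- move=> w w' /set_mem Xw /set_mem Xw' e.
  by apply: R_inj (tauR _ Xw) _; rewrite e; apply: tauR.
- move=> w Yw.
  have [b [a [r [ab Tr ->]]]] := transversal_coordinates Qg Y_sat Yw.
  have [r' Tr' r'E] := beta_surj _ Tr.
  have Xr' : X (act b r') by have [Xr' _] := Tr'; apply: X_inv ab Xr'.
  exists (act b r') => //; apply: R_fun (tauR _ Xr') _.
  by exists a, b, r'; rewrite r'E.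
Qed.

End EquivariantBijection.

(** * Self-maps of a set under composition *)

Section Transformations.
Variable W : Type.

(** Made into a monoid so that its [units] serve as the permutation group of [W]. *)
Definition transformation : Type := W -> W.

HB.instance Definition _ := gen_eqMixin transformation.
HB.instance Definition _ := gen_choiceMixin transformation.

Let transformation_mul (f g : transformation) : transformation := f \o g.

Fact transformation_mulA : associative transformation_mul.
Proof. by []. Qed.

Fact transformation_mul1 : left_id (idfun : transformation) transformation_mul.
Proof. by []. Qed.

Fact transformation_mulr1 :
  right_id (idfun : transformation) transformation_mul.
Proof. by []. Qed.

HB.instance Definition _ := isMonoid.Build transformation
  transformation_mulA transformation_mul1 transformation_mulr1.

Lemma bijective_invertible (f : transformation) : bijective f -> invertible f.
Proof.
by case=> g fK gK; exists (g : transformation); split; apply/funext => w;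
  [apply: gK|apply: fK].
Qed.

End Transformations.

(** * Extending left multiplication by the atom to a permutation *)

Section FaithfulAction.
Variables (S : monoidType) (x : S).
Hypotheses (S_rees : rees_monoid S) (x_atom : atom x).
Implicit Types (g h a b : units S) (s : S).

Let S_lcan : right_injective (@mul S).
Proof. by have [[]] := S_rees. Qed.

Let S_rcan : left_injective (@mul S).
Proof. by have [[]] := S_rees. Qed.

Definition atom_graph (a b : units S) : Prop := val a * x = x * val b.

Lemma atom_graphP : partial_automorphism_graph atom_graph.
Proof.
split=> [|a b a' b' ab ab'|a b ab|a|b].
- by rewrite /atom_graph !val_unit1 mul1g mulg1.
- by rewrite /atom_graph !val_unitM -mulgA ab' mulgA ab mulgA.
- apply: (@S_lcan (val a)); apply: (@S_rcan (val b)).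
  by rewrite /= val_unitVK mulgA ab -!mulgA val_unitV mulg1.
- rewrite /atom_graph val_unit1 mulg1 -{2}[x]mul1g => /S_rcan e.
  by apply: val_inj; rewrite e val_unit1.
- rewrite /atom_graph val_unit1 mul1g -{1}[x]mulg1 => /S_lcan e.
  by apply: val_inj; rewrite -e val_unit1.
Qed.

(* The second summand is a free G-set large enough for the injection [s |-> x s]
   of the first summand to extend to an equivariant permutation. *)
Definition extended_space : Type := (S + S * (nat -> S))%type.

HB.instance Definition _ := gen_eqMixin extended_space.
HB.instance Definition _ := gen_choiceMixin extended_space.
HB.instance Definition _ := isPointed.Build extended_space (inl 1).
Implicit Type w : extended_space.

Definition unit_act (g : units S) w : extended_space :=
  match w with
  | inl s => inl (val g * s)
  | inr (s, k) => inr (val g * s, k)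
  end.

Lemma unit_act1 w : unit_act 1 w = w.
Proof. by case: w => [s|[s k]]; rewrite /unit_act val_unit1 mul1g. Qed.

Lemma unit_actM g h w : unit_act (g * h) w = unit_act g (unit_act h w).
Proof. by case: w => [s|[s k]]; rewrite /unit_act val_unitM mulgA. Qed.

Lemma unit_act_free g w : unit_act g w = w -> g = 1.
Proof.
have can s : val g * s = s -> g = 1.
  by rewrite -{2}[s]mul1g => /S_rcan e; apply: val_inj; rewrite e val_unit1.
by case: w => [s [/can]|[s k] [/can]].
Qed.

(** An embedding of the whole space into [nat -> S], which bounds its cardinality. The entry at 0
    tells the summands apart because [x] is not 1. *)
Definition extended_code w : nat -> S :=
  match w with
  | inl s => fun n => if n is 1 then s else 1
  | inr (s, k) => fun n =>
    match n with 0 => x | 1 => s | n.+2 => k n end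
  end.

Lemma extended_code_inj : injective extended_code.
Proof.
have x_neq1 : x <> 1.
  by have [xN _] := x_atom => x1; apply: xN; exists 1; rewrite x1 mulg1.
case=> [s|[s k]] [s'|[s' k']] e; first by have /= -> := congr1 (@^~ 1%N) e.
- by have /= /esym := congr1 (@^~ 0%N) e.
- by have /= := congr1 (@^~ 0%N) e.
have /= -> := congr1 (@^~ 1%N) e; congr (inr (_, _)).
by apply/funext => n; have /= := congr1 (@^~ n.+2) e.
Qed.

Lemma atom_permutation :
  exists sigma : extended_space -> extended_space,
  [/\ bijective sigma, forall s, sigma (inl s) = inl (x * s)
    & forall a b w, atom_graph a b ->
        sigma (unit_act b w) = unit_act a (sigma w)].
Proof.
(* [X] and [Y] are the complements of the domain and of the range of [s |-> x s]. [C] has at most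
   one point in each G-orbit, and the code of a point serves as its second coordinate. *)
pose X : set extended_space := range inr.
pose Y : set extended_space := [set w | forall s, w <> inl (x * s)]%classic.
pose C : set extended_space := range (fun k => inr (1, k)).
have [|||||tau [[tau_fun tau_inj tau_surj] tau_act]] :=
    equivariant_bijection unit_act1 unit_actM unit_act_free (X := X) (Y := Y)
      (C := C) atom_graphP.
- by move=> a b _ _ [[s k] _ <-]; exists (val b * s, k).
(* If [a s = x s'], then [s = a^-1 x s' = x b^-1 s'], which [Y] excludes. *)
- move=> a b [s|[s k]] ab Yw s' //= [e]; apply: (Yw (val b^-1 * s')).
  have [_ _ PV _ _] := atom_graphP.
  by congr inl; rewrite mulgA -(PV _ _ ab) -mulgA -e val_unitK.
- by move=> _ [k _ <-]; split=> //; exists (1, k).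
- move=> g _ [k _ <-] [k' _ /= [e _]].
  by apply: val_inj; rewrite -[LHS]mulg1 -e val_unit1.
- apply/pcard_leP/injfunPex; exists (fun w => inr (1, extended_code w)).
    by move=> w _; exists (extended_code w).
  by move=> w w' _ _ [/extended_code_inj].
pose sigma w := if w is inl s then inl (x * s) else tau w.
exists sigma; split=> //; last first.
  move=> a b [s|[s k]] ab; first by rewrite /= mulgA -ab mulgA.
  by rewrite -(tau_act _ _ _ ab) //; exists (s, k).
rewrite -setTT_bijective; split=> // [w w' _ _|w _].
  (* The two branches of [sigma] have disjoint images because [tau] takes its values on [X] in
     [Y]. *)
  have tauN s k s' : tau (inr (s, k)) <> inl (x * s').
    by apply: tau_fun; exists (s, k).
  case: w w' => [s|[s k]] [s'|[s' k']] /=.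
  - by case=> /S_lcan ->.
  - by move/esym/tauN.
  - by move/tauN.
  - by apply: tau_inj; apply: mem_set; eexists.
have [Yw|/existsNP[s /contrapT ->]] := pselect (Y w); last by exists (inl s).
by have [_ [p _ <-] <-] := tau_surj _ Yw; exists (inr p).
Qed.

End FaithfulAction.

(** * The universal property of the HNN extension *)

Lemma word_eval_morph (G L : groupType) (f : monoid_hom G L) (u : word G) :
  word_eval f u = f (word_eval idfun u).
Proof.
rewrite /word_eval; elim: u => [|[g b] u IHu]; first by rewrite !big_nil gmulf1.
by rewrite !big_cons IHu gmulfM /=; case: b; rewrite ?gmulfV.
Qed.

Section HNN.
Variables (G : groupType) (A B : set G) (phi : A -> B).
Local Notation Gs := (hnn_extension phi).

Definition hnn_base (g : G) : Gs := presented_gen (hnn_rel phi) (Some g).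

Definition hnn_letter : Gs := presented_gen (hnn_rel phi) None.

Lemma hnn_baseM : {morph hnn_base : g h / g * h}.
Proof.
move=> g h; rewrite /hnn_base /presented_gen -word_classM.
apply/esym/word_classP/word_cong_rel.
apply: (@hnn_rel_base _ _ _ _ [:: (g, true); (h, true)] [:: (g * h, true)]).
by rewrite /word_eval big_cons !big_seq1.
Qed.

Lemma hnn_base1 : hnn_base 1 = 1.
Proof. by apply: (@mulgI _ (hnn_base 1)); rewrite -hnn_baseM !mulg1. Qed.

HB.instance Definition _ := isMultiplicative.Build G Gs hnn_base hnn_baseM.
HB.instance Definition _ :=
  Multiplicative_isUMagmaMorphism.Build G Gs hnn_base hnn_base1.

Lemma hnn_stable (a : A) :
  hnn_base (val a) * hnn_letter = hnn_letter * hnn_base (val (phi a)).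
Proof.
rewrite /hnn_base /hnn_letter /presented_gen -!word_classM.
exact/word_classP/word_cong_rel/hnn_rel_stable.
Qed.

Lemma hnn_lift (L : groupType) (f : monoid_hom G L) (t : L) :
  (forall a : A, f (val a) * t = t * f (val (phi a))) ->
  exists F : monoid_hom Gs L,
    (forall g, F (hnn_base g) = f g) /\ F hnn_letter = t.
Proof.
move=> ft; pose h (o : option G) := if o is Some g then f g else t.
have hR u v : hnn_rel phi u v -> word_eval h u = word_eval h v.
  case=> [{}u {}v e|a]; last first.
    by rewrite /word_eval !big_cons !big_nil !mulg1 /= ft.
  have base_eval w : word_eval h [seq (Some p.1, p.2) | p <- w] = word_eval f w.
    by rewrite /word_eval big_map.
  by rewrite !base_eval !(word_eval_morph f) e.
pose m := isMultiplicative.Build _ _ _ (presented_liftM hR).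
pose m1 := Multiplicative_isUMagmaMorphism.Build _ _ _ (presented_lift1 hR).
pose F : monoid_hom Gs L := HB.pack (presented_lift (R := hnn_rel phi) h) m m1.
by exists F; split=> [g|]; rewrite /F /= presented_lift_gen.
Qed.

Lemma hnn_hom_ext (L : groupType) (F F' : monoid_hom Gs L) :
  (forall g, F (hnn_base g) = F' (hnn_base g)) ->
  F hnn_letter = F' hnn_letter -> F =1 F'.
Proof.
by move=> Fb Ft; apply: presented_ext => -[g|]; [apply: Fb|apply: Ft].
Qed.

End HNN.

(** * Permutation representations, the isomorphism and the embedding *)

Lemma transformation_hom (G : groupType) (W : Type) (act : G -> W -> W) :
  (forall w, act 1 w = w) -> (forall g h w, act (g * h) w = act g (act h w)) ->
  exists f : monoid_hom G (units (transformation W)),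
    forall g, val (f g) = act g.
Proof.
move=> act1 actM.
have inv g : invertible (act g : transformation W).
  by apply: bijective_invertible; exists (act g^-1) => w;
    rewrite -actM ?mulgV ?mulVg act1.
pose f g : units (transformation W) := Units (asboolT (inv g)).
have fM : {morph f : g h / g * h}.
  by move=> g h; apply: val_inj; apply/funext => w; apply: actM.
have f1 : f 1 = 1 by apply: val_inj; apply/funext => w; apply: act1.
pose m := isMultiplicative.Build _ _ f fM.
pose m1 := Multiplicative_isUMagmaMorphism.Build _ _ f f1.
pose fhom : monoid_hom G (units (transformation W)) := HB.pack f m m1.
by exists fhom.
Qed.

Theorem proposition5p2 (S : monoidType) (A B : set (units S)) (phi : A -> B) :
  rees_monoid S -> irreducible_monoid S ->
  associated_partial_automorphism phi ->
  (forall (U : groupType) (iota : monoid_hom S U),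
      is_universal_group iota ->
      exists f : monoid_hom U (hnn_extension phi), bijective f) /\
  (exists f : monoid_hom S (hnn_extension phi), injective f).
Proof.
move=> S_rees S_irr [x [x_atom AE BE phiE]].
have phi_x (a : A) : atom_graph x (val a) (val (phi a)) by apply/phiE.
(* Such a relation puts [a] in [A] and [b] in [B] with [phi a = b], so it is an instance of a
   defining relation of the HNN extension. *)
have base_letter (a b : units S) : val a * x = x * val b ->
    hnn_base phi a * hnn_letter phi = hnn_letter phi * hnn_base phi b.
  move=> ab.
  have Aa : A a by rewrite AE; exists b.
  have Bb : B b by rewrite BE; exists a.
  have /= := hnn_stable phi (SigSub (mem_set Aa)).
  by have -> : phi (SigSub (mem_set Aa)) = SigSub (mem_set Bb) by apply/phiE.
have [f [f_unit f_x]] := rees_lift S_rees S_irr x_atom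
  (gam := hnn_base phi) base_letter.
split; last first.
  exists f.
  have [rho rhoE] := transformation_hom (@unit_act1 S) (@unit_actM S).
  have [sigma [sigma_bij sigma_x sigma_act]] := atom_permutation S_rees x_atom.
  pose t : units (transformation (extended_space S)) :=
    Units (asboolT (bijective_invertible sigma_bij)).
  have rho_t (a : A) : rho (val a) * t = t * rho (val (phi a)).
    apply: val_inj; apply/funext => w.
    by rewrite !val_unitM /mul /= !rhoE (sigma_act _ _ _ (phi_x a)).
  have [F [F_base F_t]] := hnn_lift rho_t.
  (* On the first summand [F (f s)] acts as left multiplication by [s]; evaluating at [inl 1] will
     give injectivity. *)
  have FfE s s' : val (F (f s)) (inl s') = inl (s * s').
    elim/(rees_ind S_rees S_irr x_atom): s s' => [g||a b IHa IHb] s'.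
    - by rewrite f_unit F_base rhoE.
    - by rewrite f_x F_t /= sigma_x.
    - by rewrite !gmulfM /mul /= IHb IHa mulgA.
  move=> s s' e; have := FfE s 1.
  by rewrite e FfE !mulg1 => -[].
move=> U iota iota_univ.
have [fbar [fbarE _]] := iota_univ _ f.
have [|k [k_base k_t]] := hnn_lift (phi := phi) (f := iota \o val) (t := iota x).
  by move=> a; rewrite /= -!gmulfM phi_x.
(* Uniqueness is stated against a chosen factorization, here [id'] of [iota] through itself; both
   the identity and [k \o fbar] are compared with it. *)
have [id' [_ id_uniq]] := iota_univ U iota.
exists fbar, k => [u|w].
  rewrite -[RHS](_ : id' u = u); last by rewrite -(id_uniq idfun).
  apply: (id_uniq (k \o fbar)) => s /=; rewrite -[fbar _]fbarE.
  apply: (@rees_hom_ext _ _ S_rees S_irr x_atom _ iota (k \o f)) => [g|] /=.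
    by rewrite f_unit k_base.
  by rewrite f_x k_t.
(* The other composite need only be checked on G and the letter. *)
apply: (@hnn_hom_ext _ _ _ _ _ (fbar \o k) idfun) => [g|] /=.
  by rewrite k_base /= -[LHS]fbarE f_unit.
by rewrite k_t -[LHS]fbarE f_x.
Qed.
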